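(* Let $X = \xi(t,u,v)\,\partial_t + \eta_u(t,u,v)\,\partial_u + \eta_v(t,u,v)\,\partial_v$ be a smooth vector field on $M_3$ with $\partial_t\eta_u = 0$ and $\partial_t\eta_v = 0$, and let $X^{(1)}$ be its prolongation to $J_5$. Then the push-forward $f_*\left(X^{(1)}\right)$ of $X^{(1)}$ by the map $$f : J_5 \to J_3, \qquad f(t,u,v,\dot u,\dot v) = \left(u,v,\frac{\dot v}{\dot u}\right)$$ (defined where $\dot u \neq 0$) is a well-defined vector field on $J_3$, and it coincides with the prolongation $\left(f_*X\right)^{(1)}$ to $J_3$ of the push-forward $f_*X$ of $X$ by the induced map $f : M_3 \to M_2$, $f(t,u,v) = (u,v)$.
   Context: Let $U \subseteq \mathbb{R}^2$ be open, with coordinates $(u,v)$. Put $M_2 = U$, $M_3 = \mathbb{R}\times U$ with coordinates $(t,u,v)$, $J_5 = M_3\times\mathbb{R}^2$ with coordinates $(t,u,v,\dot u,\dot v)$ (first jet space with independent variable $t$ and dependent variables $u,v$), and $J_3 = M_2\times\mathbb{R}$ with coordinates $(u,v,v')$ (first jet space with independent variable $u$ and dependent variable $v$). The map $f$ on $J_5$ is considered on the open set $\{\dot u\neq 0\}$. Prolongation in the time domain: for $X = \xi\partial_t+\eta_u\partial_u+\eta_v\partial_v$ on $M_3$ (subscripts on $\eta$ are labels, not derivatives), $$X^{(1)} = X + \eta_u^{(1)}\partial_{\dot u} + \eta_v^{(1)}\partial_{\dot v},\quad \eta_u^{(1)} = D_t\eta_u - \dot u D_t\xi,\quad \eta_v^{(1)}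 = D_t\eta_v - \dot v D_t\xi,\quad D_t = \partial_t+\dot u\partial_u+\dot v\partial_v .$$ Prolongation in the phase plane: for $Y = \zeta_u(u,v)\partial_u+\zeta_v(u,v)\partial_v$ on $M_2$ (subscripts on $\zeta$ are labels), $$Y^{(1)} = Y + \zeta_v^{(1)}\partial_{v'},\quad \zeta_v^{(1)} = D_u\zeta_v - v' D_u\zeta_u,\quad D_u = \partial_u+v'\partial_v .$$ Push-forward: for a vector field $Z$ on the domain of $f$, $f_*Z$ assigns to the point $f(x)$ the vector $df_x(Z_x)$; it is a well-defined vector field if $df_x(Z_x)$ depends only on $f(x)$ (i.e. $Z$ is $f$-related to a vector field on the target). *)

(* Defs.v *)
From HB Require Import structures.
From mathcomp Require Import all_boot all_order all_algebra.
From mathcomp Require Import all_classical all_reals all_analysis.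

Set Implicit Arguments.
Unset Strict Implicit.
Unset Printing Implicit Defensive.

Import Order.TTheory GRing.Theory Num.Theory.
Import numFieldNormedType.Exports.

Local Open Scope classical_set_scope.
Local Open Scope ring_scope.

Section Smooth.
Context {R : realType} {V W : normedModType R}.

(* Meant for finite-dimensional V and W: there, x |-> 'd f x is C^k as a map
   into the linear maps iff x |-> 'd f x v is C^k for every vector v. *)
Fixpoint Ck_on (k : nat) (D : set V) (f : V -> W) : Prop :=
  match k with
  | 0%N => forall x, D x -> {for x, continuous f}
  | k'.+1 => (forall x, D x -> differentiable f x) /\
             (forall v : V, Ck_on k' D (fun x => 'd f x v))
  end.

Definition smooth_on (D : set V) (f : V -> W) : Prop :=
  forall k, Ck_on k D f.

End Smooth.

Section Pushforward.
Context {R : realType} {V W : normedModType R}.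
Variables (f : V -> W) (D : set V).

(* The tangent space at each point of V is identified with V itself, so a
   vector field on D is a map V -> V of which only the values on D matter. *)

Definition vf_pushforward (Z : V -> V) (y : W) : W :=
  get [set w | exists x, [/\ D x, f x = y & 'd f x (Z x) = w]].

(* Under the first two clauses, the set from which vf_pushforward selects is a
   singleton at every point of E. *)
Definition vf_pushforward_well_defined (E : set W) (Z : V -> V) : Prop :=
  [/\ f @` D = E,
      forall x x', D x -> D x' -> f x = f x' ->
        'd f x (Z x) = 'd f x' (Z x') &
      smooth_on E (vf_pushforward Z)].

End Pushforward.

Section Jets.
Context {R : realType}.

(* Coordinates: (u, v) in R * R; (t, (u, v)) in R * (R * R);
   ((t, (u, v)), (u', v')) in (R * (R * R)) * (R * R), with u', v' the time
   derivatives; ((u, v), v') in (R * R) * R, with v' the u-derivative. *)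

Definition M3 (U : set (R * R)) : set (R * (R * R)) := setT `*` U.

(* The part of the first jet space over M3 U on which u' is nonzero. *)
Definition J5_reg (U : set (R * R)) : set ((R * (R * R)) * (R * R)) :=
  M3 U `*` [set w | w.1 != 0].

Definition J3 (U : set (R * R)) : set ((R * R) * R) := U `*` setT.

Definition M3_to_M2 (x : R * (R * R)) : R * R := x.2.

Definition J5_to_J3 (p : (R * (R * R)) * (R * R)) : (R * R) * R :=
  (p.1.2, p.2.2 / p.2.1).

Definition vfield3 (xi eta_u eta_v : R * (R * R) -> R)
  (x : R * (R * R)) : R * (R * R) := (xi x, (eta_u x, eta_v x)).

Definition partial_t (g : R * (R * R) -> R) (x : R * (R * R)) : R :=
  'D_(1, (0, 0)) g x.
Definition partial_u (g : R * (R * R) -> R) (x : R * (R * R)) : R :=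
  'D_(0, (1, 0)) g x.
Definition partial_v (g : R * (R * R) -> R) (x : R * (R * R)) : R :=
  'D_(0, (0, 1)) g x.

Definition total_t (g : R * (R * R) -> R)
  (p : (R * (R * R)) * (R * R)) : R :=
  partial_t g p.1 + p.2.1 * partial_u g p.1 + p.2.2 * partial_v g p.1.

Definition prolong_time (X : R * (R * R) -> R * (R * R))
  (p : (R * (R * R)) * (R * R)) : (R * (R * R)) * (R * R) :=
  let xi x := (X x).1 in
  let eta_u x := (X x).2.1 in
  let eta_v x := (X x).2.2 in
  (X p.1, (total_t eta_u p - p.2.1 * total_t xi p,
           total_t eta_v p - p.2.2 * total_t xi p)).

Definition total_u (g : R * R -> R) (q : (R * R) * R) : R :=
  'D_(1, 0) g q.1 + q.2 * 'D_(0, 1) g q.1.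

Definition prolong_phase (Y : R * R -> R * R) (q : (R * R) * R) :
  (R * R) * R :=
  let zeta_u y := (Y y).1 in
  let zeta_v y := (Y y).2 in
  (Y q.1, total_u zeta_v q - q.2 * total_u zeta_u q).

End Jets.

(* Main.v *)
Require Import Defs.
From mathcomp Require Import all_boot all_order all_algebra.
From mathcomp Require Import ring.
From mathcomp Require Import all_classical all_reals all_analysis.

Set Implicit Arguments.
Unset Strict Implicit.
Unset Printing Implicit Defensive.

Import Order.TTheory GRing.Theory Num.Theory.
Import numFieldNormedType.Exports.

Local Open Scope classical_set_scope.
Local Open Scope ring_scope.

(** If f maps D onto E and a field Z on D is related to a field G on E, that is
    ['d f x (Z x) = G (f x)] for every x in D, then at each point y of E the set
    that [vf_pushforward] selects from is the singleton of [G y].  So the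
    push-forward is G on E ([vf_pushforwardE]), and it is well defined when G is
    smooth ([vf_pushforward_well_definedP]).  For both maps of the theorem it is
    therefore enough to guess G.

    Since the t-derivatives of eta_u and eta_v vanish and the fibres of
    [M3 U] over U are whole lines, both functions are constant along the fibres
    ([constant_along_time]).  Hence X is related to the slice
    S y = (eta_u (0, y), eta_v (0, y)), and it remains to relate the time
    prolongation of X to the phase prolongation of S.  The first two components
    are immediate.  By the quotient rule ([is_diff_J5_to_J3]) the third one is
    (eta_v^(1) u' - v' eta_u^(1)) / u'^2, where the two terms u' v' D_t xi
    cancel; what is left is (u' D_t eta_v - v' D_t eta_u) / u'^2.  On functions
    of (u, v) alone D_t is u' D_u with slope v'/u', so this equals
    D_u eta_v - (v'/u') D_u eta_u, the prolongation formula in the phase plane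
    ([slope_variation]).

    The remaining work is the calculus of smooth functions needed to see that
    the slice and its prolongation are smooth: the C^k classes on an open set
    are stable under sums, products, pairing, linear maps on the left and
    affine maps on the right. *)

(** * C^k functions on open sets *)

Section Ck.
Context {R : realType}.

Lemma is_diff_fst (V W : normedModType R) (x : V * W) :
  is_diff x (@fst V W) (@fst V W).
Proof.
have c : continuous (@fst V W) by move=> p; exact: cvg_fst.
by apply: DiffDef; [exact: linear_differentiable | exact: diff_lin].
Qed.

Lemma is_diff_snd (V W : normedModType R) (x : V * W) :
  is_diff x (@snd V W) (@snd V W).
Proof.
have c : continuous (@snd V W) by move=> p; exact: cvg_snd.
by apply: DiffDef; [exact: linear_differentiable | exact: diff_lin].
Qed.

(** The differential depends only on the germ of the function, because the
    first-order expansion that characterizes it does. *)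
Lemma near_eq_is_diff (V W : normedModType R) (f g df : V -> W) x :
  (\near x, f x = g x) -> is_diff x f df -> is_diff x g df.
Proof.
move=> fg [dfx <-].
have cdf : continuous ('d f x) by apply: diff_continuous.
have gE : g \o shift x = cst (g x) + 'd f x +o_ 0 id.
  apply/eqaddoP => e e0.
  have /eqaddoP/(_ _ e0) := diff_locally dfx.
  have fg0 : \forall h \near (0 : V), f (h + x) = g (h + x).
    have cx : shift x @ (0 : V) --> x.
      by rewrite -[X in _ --> X](add0r x); apply: cvgD; [exact: cvg_id|exact: cvg_cst].
    exact: (cx (fun y => f y = g y) fg).
  apply: filterS2 fg0 => h /= fgh.
  by rewrite !fctE /= fgh (nbhs_singleton fg).
apply: DiffDef; last exact: diff_unique.
by apply/diff_locallyP; rewrite (diff_unique cdf gE).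
Qed.

Section OneDomain.
Context {V W : normedModType R}.
Implicit Types (D : set V) (f g : V -> W).

(** Openness makes the two functions agree near every point of D, so that all
    their iterated differentials agree on D too.  This lets each stability proof
    below use a differentiation rule that holds on D only. *)
Lemma Ck_on_eq k D f g : open D -> (forall x, D x -> f x = g x) ->
  Ck_on k D f -> Ck_on k D g.
Proof.
move=> oD; have near_D x : D x -> forall P : V -> Prop, (forall y, D y -> P y) ->
    \near x, P x.
  by move=> Dx P DP; apply: filterS DP _; exact: open_nbhs_nbhs.
elim: k f g => [|k IH] f g fg /=.
  move=> cf x Dx; change (g y @[y --> x] --> g x); rewrite -(fg x Dx).
  apply: cvg_trans (cf x Dx); apply: near_eq_cvg.
  exact: (near_D x Dx (fun y => f y = g y)).
move=> [df Cf].
have dg x : D x -> is_diff x g ('d f x).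
  move=> Dx; apply: (@near_eq_is_diff _ _ f); first exact: near_D.
  by apply: DiffDef => //; exact: df.
split=> [x Dx|v]; first by have := dg x Dx => ?; exact: ex_diff.
apply: IH (Cf v) => x Dx.
by have dgx := dg x Dx; rewrite (@diff_val _ _ _ _ _ _ _ dgx).
Qed.

Lemma Ck_on_pred k D f : Ck_on k.+1 D f -> Ck_on k D f.
Proof.
elim: k f => [|k IH] f /= [df Cf].
  by move=> x Dx; exact/differentiable_continuous/df.
by split=> // v; apply: IH; exact: Cf.
Qed.

Lemma Ck_on_cst k D (c : W) : Ck_on k D (cst c).
Proof.
elim: k c => [|k IH] c /=; first by move=> x _; exact: cst_continuous.
split=> [x _|v]; first exact: differentiable_cst.
by under eq_fun do rewrite diff_cst; exact: IH.
Qed.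

End OneDomain.

(** The map [dA] does not depend on the base point, which is how the hypothesis
    says that A is affine.  Differentiating [f \o A] in the direction v then
    gives [(fun y => 'd f y (dA v)) \o A], a composite of the same form, and the
    induction closes. *)
Lemma Ck_on_comp_affine (V V' W : normedModType R) k (D' : set V')
    (D : set V) (A dA : V' -> V) (f : V -> W) :
  open D' -> (forall x, is_diff x A dA) -> (forall x, D' x -> D (A x)) ->
  Ck_on k D f -> Ck_on k D' (f \o A).
Proof.
move=> oD' dAE AD; elim: k f => [|k IH] f /=.
  move=> cf x Dx; apply: continuous_comp; last exact/cf/AD.
  exact: (@differentiable_continuous _ _ _ _ _ (@ex_diff _ _ _ _ _ _ _ (dAE x))).
move=> [df Cf]; split=> [x Dx|v].
  by apply: differentiable_comp; [exact: (@ex_diff _ _ _ _ _ _ _ (dAE x))|exact/df/AD].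
apply: (@Ck_on_eq _ _ _ _ ((fun y => 'd f y (dA v)) \o A)) => //.
  move=> x Dx; have dfA := df _ (AD x Dx); have := dAE x => dAx.
  by rewrite diff_comp//= (@diff_val _ _ _ _ _ _ _ dAx).
exact: IH.
Qed.

(** A continuous linear map is recognized by being its own differential
    everywhere. *)
Lemma Ck_on_linear_comp (V W W' : normedModType R) k (D : set V)
    (f : V -> W) (L : W -> W') :
  open D -> (forall x, is_diff x L L) -> Ck_on k D f -> Ck_on k D (L \o f).
Proof.
move=> oD dL; elim: k f => [|k IH] f /=.
  move=> cf x Dx; apply: continuous_comp; first exact: cf.
  exact: (@differentiable_continuous _ _ _ _ _ (@ex_diff _ _ _ _ _ _ _ (dL _))).
move=> [df Cf]; split=> [x Dx|v].
  by apply: differentiable_comp; [exact/df|exact: (@ex_diff _ _ _ _ _ _ _ (dL _))].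
apply: (@Ck_on_eq _ _ _ _ (L \o (fun y => 'd f y v))) => //; last exact: IH.
move=> x Dx; have dfx := df x Dx; have := dL (f x) => dLx.
by rewrite diff_comp//= (@diff_val _ _ _ _ _ _ _ dLx).
Qed.

Lemma Ck_onD (V W : normedModType R) k (D : set V) (f g : V -> W) :
  open D -> Ck_on k D f -> Ck_on k D g -> Ck_on k D (f + g).
Proof.
move=> oD; elim: k f g => [|k IH] f g /=.
  by move=> cf cg x Dx; apply: cvgD; [exact: cf|exact: cg].
move=> [df Cf] [dg Cg]; split=> [x Dx|v].
  by apply: differentiableD; [exact: df|exact: dg].
apply: Ck_on_eq (IH _ _ (Cf v) (Cg v)) => // x Dx.
by rewrite diffD//; [exact: df|exact: dg].
Qed.

(** Leibniz' rule brings in the undifferentiated factors, which are only used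
    one order below what is assumed of them. *)
Lemma Ck_onM (V : normedModType R) k (D : set V) (f g : V -> R) :
  open D -> Ck_on k D f -> Ck_on k D g -> Ck_on k D (f * g).
Proof.
move=> oD; elim: k f g => [|k IH] f g.
  by move=> cf cg x Dx; apply: cvgM; [exact: cf|exact: cg].
move=> Cf Cg; have Cf' := Ck_on_pred Cf; have Cg' := Ck_on_pred Cg.
move: Cf Cg => [df Cf] [dg Cg]; split=> [x Dx|v].
  by apply: differentiableM; [exact: df|exact: dg].
apply: (@Ck_on_eq _ _ _ _
  (f * (fun x => 'd g x v) + g * (fun x => 'd f x v))) => //; last first.
  apply: Ck_onD => //; first by apply: IH; [exact: Cf'|exact: Cg].
  by apply: IH; [exact: Cg'|exact: Cf].
by move=> x Dx; rewrite diffM//; [exact: df|exact: dg].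
Qed.

(** A pair is the sum of its images under the two axis inclusions, both linear. *)
Lemma Ck_on_pair (V W W' : normedModType R) k (D : set V)
    (f : V -> W) (g : V -> W') :
  open D -> Ck_on k D f -> Ck_on k D g -> Ck_on k D (fun x => (f x, g x)).
Proof.
move=> oD Cf Cg.
have inlE (w : W) : is_diff w (fun w : W => (w, 0 : W')) (fun w : W => (w, 0 : W')).
  exact: is_diff_pair.
have inrE (w : W') : is_diff w (fun w : W' => (0 : W, w)) (fun w : W' => (0 : W, w)).
  exact: is_diff_pair.
apply: Ck_on_eq (Ck_onD oD (Ck_on_linear_comp oD inlE Cf)
                            (Ck_on_linear_comp oD inrE Cg)) => // x _.
by congr (_, _); rewrite /= ?addr0 ?add0r.
Qed.

End Ck.

(** * Push-forward of related vector fields *)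

Section Pushforward.
Context {R : realType} {V W : normedModType R}.
Context (f : V -> W) (D : set V) (E : set W) (Z : V -> V) (G : W -> W).
Context (related : forall x, D x -> 'd f x (Z x) = G (f x)).
Context (fDE : f @` D = E).

Lemma vf_pushforwardE y : E y -> vf_pushforward f D Z y = G y.
Proof.
rewrite -fDE => -[x Dx fxy]; rewrite /vf_pushforward; set P := [set w | _].
have : P (get P) by apply: getPex; exists (G y), x; rewrite related// fxy.
by move=> [x' [Dx' fx'y <-]]; rewrite related// fx'y.
Qed.

Lemma vf_pushforward_well_definedP :
  open E -> smooth_on E G -> vf_pushforward_well_defined f D E Z.
Proof.
move=> oE sG; split=> // [x x' Dx Dx' fxx'|k]; first by rewrite !related// fxx'.
by apply: (Ck_on_eq oE _ (sG k)) => y Ey; rewrite vf_pushforwardE.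
Qed.

End Pushforward.

(** * Functions that do not depend on time *)

Section TimeIndependent.
Context {R : realType}.
Implicit Types (g : R * (R * R) -> R).

(** Along the line through y of direction w the two difference quotients are the
    same function of h, so their limits agree, even as default values. *)
Lemma derive_comp_affine (V V' W : normedModType R) (g : V -> W) (A : V' -> V)
    (y w : V') (v : V) :
  (forall h : R, A (h *: w + y) = h *: v + A y) ->
  'D_v g (A y) = 'D_w (g \o A) y.
Proof.
move=> AE; rewrite /derive; congr (lim _).
set F := (F in F @ _ = _); set F' := (F in _ = F @ _).
have -> : F = F' by apply/funext => h; rewrite /F /F' /= AE.
by [].
Qed.

Lemma partial_tE g t y : partial_t g (t, y) = 'D_1 (fun s => g (s, y)) t.
Proof.
apply: (@derive_comp_affine _ _ _ g (fun s => (s, y))) => h; case: y => a b.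
by congr (_, (_, _)); rewrite /= ?scaler0 ?add0r.
Qed.

Lemma derive_spatial g t y w :
  'D_(0, w) g (t, y) = 'D_w (fun z => g (t, z)) y.
Proof.
apply: (@derive_comp_affine _ _ _ g (fun z => (t, z))) => h.
by congr (_, _); rewrite /= ?scaler0 ?add0r.
Qed.

(** The fibre of [M3 U] over y is a whole line, hence connected: a vanishing
    derivative along it forces a constant. *)
Lemma constant_along_time (U : set (R * R)) g :
  (forall x, M3 U x -> differentiable g x) ->
  (forall x, M3 U x -> partial_t g x = 0) ->
  forall t y, U y -> g (t, y) = g (0, y).
Proof.
move=> dg g0 t y Uy; apply: (@is_derive_0_is_cst _ (fun s => g (s, y))) => s.
apply: DeriveDef; last by rewrite -partial_tE g0.
apply: diff_derivable.
apply: (@differentiable_comp _ _ _ _ (fun s : R => (s, y)) g); last exact: dg.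
by apply: differentiable_pair.
Qed.

End TimeIndependent.

(** * Prolongations and the slope map *)

Section Prolongation.
Context {R : realType}.
Implicit Types (U : set (R * R)) (S : R * R -> R * R).

Lemma open_J3 U : open U -> open (J3 U).
Proof.
move=> oU; have -> : J3 U = fst @^-1` U.
  by apply/seteqP; split=> q /= => [[]|Uq] //; split.
by apply: open_comp => // q _; exact: cvg_fst.
Qed.

(** Prolongation is local: it involves S only through its germ at [q.1]. *)
Lemma eq_prolong_phase U S S' : open U -> (forall y, U y -> S y = S' y) ->
  forall q, J3 U q -> prolong_phase S q = prolong_phase S' q.
Proof.
move=> oU SS' q [Uq _]; rewrite /prolong_phase /total_u (SS' _ Uq).
have nU : \forall y \near q.1, S y = S' y.
  by apply: filterS SS' _; exact: open_nbhs_nbhs.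
have near1 : \forall y \near q.1, (S y).1 = (S' y).1 by apply: filterS nU => y ->.
have near2 : \forall y \near q.1, (S y).2 = (S' y).2 by apply: filterS nU => y ->.
by rewrite !(near_eq_derive _ near1) !(near_eq_derive _ near2).
Qed.

(** One derivative of S is lost, which smoothness can afford; in the remaining
    coordinate v' the prolongation is polynomial. *)
Lemma smooth_prolong_phase U S : open U -> smooth_on U S ->
  smooth_on (J3 U) (prolong_phase S).
Proof.
move=> oU sS k; have oJ := open_J3 oU.
have fstJ (x : R * R * R) : J3 U x -> U x.1 by case.
have dfst := @is_diff_fst R (R * R)%type R.
have C1 : smooth_on U (fst \o S).
  by move=> i; apply: Ck_on_linear_comp (sS i) => // x; exact: is_diff_fst.
have C2 : smooth_on U (snd \o S).
  by move=> i; apply: Ck_on_linear_comp (sS i) => // x; exact: is_diff_snd.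
have Csnd : Ck_on k (J3 U) (@snd (R * R) R).
  have Cid : Ck_on k (J3 U) (@idfun (R * R * R)).
    case: k => [x _|i]; first exact: cvg_id.
    split=> [x _|v]; first exact: ex_diff.
    under eq_fun do rewrite diff_val.
    exact: Ck_on_cst.
  exact: (Ck_on_linear_comp oJ (@is_diff_snd R (R * R)%type R) Cid).
have CD (z : R * R -> R) w : smooth_on U z -> Ck_on k (J3 U) (fun q => 'D_w z q.1).
  move=> sz; have [dz Cz] := sz k.+1.
  apply: (@Ck_on_eq _ _ _ _ _ ((fun y => 'd z y w) \o fst)) => //.
    by move=> x [Ux _]; rewrite deriveE//; exact: dz.
  exact: (Ck_on_comp_affine oJ dfst fstJ (Cz w)).
have Ctot z : smooth_on U z -> Ck_on k (J3 U) (total_u z).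
  move=> sz; apply: Ck_onD => //; first exact: CD.
  by apply: Ck_onM => //; exact: CD.
apply: Ck_on_pair => //.
  exact: (Ck_on_comp_affine oJ dfst fstJ (sS k)).
apply: (@Ck_on_eq _ _ _ _ _
   (total_u (snd \o S) + cst (-1) * (snd * total_u (fst \o S)))) => //.
  by move=> x _; rewrite !fctE mulN1r.
apply: Ck_onD => //; first exact: Ctot.
apply: Ck_onM => //; first exact: Ck_on_cst.
by apply: Ck_onM => //; exact: Ctot.
Qed.

Lemma is_diff_J5_to_J3 (p : (R * (R * R)) * (R * R)) : p.2.1 != 0 ->
  is_diff p J5_to_J3
    (fun w => (w.1.2, (w.2.2 * p.2.1 - p.2.2 * w.2.1) / p.2.1 ^+ 2)).
Proof.
move=> p0.
have d1 : is_diff p (snd \o fst) (snd \o fst).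
  by apply: is_diff_comp; [exact: is_diff_fst|exact: is_diff_snd].
have dN : is_diff p (snd \o snd) (snd \o snd).
  by apply: is_diff_comp; exact: is_diff_snd.
have dM : is_diff p (fst \o snd) (fst \o snd).
  by apply: is_diff_comp; [exact: is_diff_snd|exact: is_diff_fst].
have dV : is_diff p (fun q => ((fst \o snd) q)^-1)
    (- (((fst \o snd) p) ^- 2) *: (fst \o snd)).
  apply: DiffDef; first by apply: differentiableV => //; exact: ex_diff.
  by rewrite diffV ?diff_val//; exact: ex_diff.
apply: (is_diff_eq (is_diff_pair d1 (is_diffM dN dV))).
apply/funext => w; congr (_, _); rewrite !fctE /= /GRing.scale /=.
by field.
Qed.

End Prolongation.

(** The left-hand side is the variation of the slope b / a under the time
    prolongation, with T for D_t xi, the leading zeros for the vanishing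
    t-derivatives, and uu, uv, vu, vv for the u- and v-derivatives of eta_u and
    eta_v.  The terms in T cancel: reparametrizing time does not move slopes. *)
Lemma slope_variation (F : fieldType) (a b T uu uv vu vv : F) : a != 0 ->
  ((0 + a * vu + b * vv - b * T) * a - b * (0 + a * uu + b * uv - a * T))
    / a ^+ 2 =
  vu + b / a * vv - b / a * (uu + b / a * uv).
Proof. by move=> a0; field. Qed.

Theorem theorem1 (R : realType) (U : set (R * R)) (hU : open U)
  (xi eta_u eta_v : R * (R * R) -> R)
  (hX : smooth_on (M3 U) (vfield3 xi eta_u eta_v))
  (heta_u : forall x, M3 U x -> partial_t eta_u x = 0)
  (heta_v : forall x, M3 U x -> partial_t eta_v x = 0) :
  let X := vfield3 xi eta_u eta_v in
  [/\ vf_pushforward_well_defined M3_to_M2 (M3 U) U X,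
      vf_pushforward_well_defined J5_to_J3 (J5_reg U) (J3 U) (prolong_time X) &
      forall q, J3 U q ->
        vf_pushforward J5_to_J3 (J5_reg U) (prolong_time X) q =
        prolong_phase (vf_pushforward M3_to_M2 (M3 U) X) q].
Proof.
move=> X.
pose S (y : R * R) := (eta_u (0, y), eta_v (0, y)).
have M3E t y : U y -> M3 U (t, y) by [].
have dX x : M3 U x -> differentiable X x by have [dX _] := hX 1%N; exact: dX.
have deta_u x : M3 U x -> differentiable eta_u x.
  move=> /dX dXx; apply: (@differentiable_comp _ _ _ _ X (fst \o snd)) => //.
  have := is_diff_comp (is_diff_snd (X x)) (is_diff_fst _) => ?.
  exact: ex_diff.
have deta_v x : M3 U x -> differentiable eta_v x.
  move=> /dX dXx; apply: (@differentiable_comp _ _ _ _ X (snd \o snd)) => //.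
  have := is_diff_comp (is_diff_snd (X x)) (is_diff_snd _) => ?.
  exact: ex_diff.
have eta_u0 := constant_along_time deta_u heta_u.
have eta_v0 := constant_along_time deta_v heta_v.
(* All slices of such a g agree on U, a neighbourhood of y, so they have the
   same derivatives at y. *)
have D_slice (g : R * (R * R) -> R) t y w :
    (forall t y, U y -> g (t, y) = g (0, y)) -> U y ->
    'D_(0, w) g (t, y) = 'D_w (fun z => g (0, z)) y.
  move=> g0 Uy; rewrite derive_spatial; apply: near_eq_derive.
  by apply: filterS (g0 t) _; exact: open_nbhs_nbhs.
have sS : smooth_on U S.
  move=> k; have dA (x : R * R) : is_diff x (fun y => (0 : R, y)) (fun y => (0 : R, y)).
    exact: is_diff_pair.
  apply: (@Ck_on_linear_comp _ _ _ _ _ _ (X \o (fun y => (0, y))) snd) => //.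
    exact: is_diff_snd.
  exact: (Ck_on_comp_affine hU dA (fun y => M3E 0 y) (hX k)).
have rel2 x : M3 U x -> 'd M3_to_M2 x (X x) = S (M3_to_M2 x).
  case: x => t y [_ Uy]; have dsnd := is_diff_snd (t, y).
  by rewrite (@diff_val _ _ _ _ _ _ _ dsnd) /= /X /vfield3 /= eta_u0// eta_v0.
have im2 : M3_to_M2 @` M3 U = U.
  by apply/seteqP; split=> [_ [x [_ Ux] <-]|y Uy] //; exists (0, y).
have rel3 p : J5_reg U p ->
    'd J5_to_J3 p (prolong_time X p) = prolong_phase S (J5_to_J3 p).
  case: p => -[t y] [a b] [[_ /= Uy] /= a0].
  have dp := @is_diff_J5_to_J3 R ((t, y), (a, b)) a0.
  rewrite (@diff_val _ _ _ _ _ _ _ dp) /prolong_time /prolong_phase /=.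
  rewrite /total_t /total_u /= heta_u// heta_v// /partial_u /partial_v.
  rewrite !(D_slice eta_u)// !(D_slice eta_v)// eta_u0// eta_v0//.
  by congr (_, _); exact: slope_variation.
have im3 : J5_to_J3 @` J5_reg U = J3 U.
  apply/seteqP; split=> [_ [p [[_ Up] _] <-]|[y s] [Uy _]]; first by split.
  (* Any velocity of slope s would do; the one with u' = 1 is (1, s). *)
  exists ((0, y), (1, s)); first by split=> //=; rewrite oner_neq0.
  by rewrite /J5_to_J3 /= divr1.
split; first exact: (vf_pushforward_well_definedP rel2 im2).
  apply: (vf_pushforward_well_definedP rel3 im3); first exact: open_J3.
  exact: smooth_prolong_phase.
move=> q Jq; rewrite (vf_pushforwardE rel3 im3 Jq).
apply: (eq_prolong_phase hU _ Jq) => y Uy.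
by rewrite (vf_pushforwardE rel2 im2 Uy).
Qed.
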